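(* Let $\omega = e^{2\pi i/3}$. Let $\Gamma\subset\mathbb{H}\rtimes S^1$ be a Heisenberg Bieberbach group satisfying $\mathrm{pr}_2(\Gamma)=\langle\omega\rangle$. Put $\Lambda=\Gamma\cap\mathbb{H}$, $N=\#(Z(\Lambda)/[\Lambda,\Lambda])$ and $c=4\operatorname{Im}\omega/N$. Define $$\Gamma_c := \langle\Lambda_{\omega,c},\ \varphi := (\omega/2,\ c/3+\operatorname{Im}\omega/6)\,\mu(\omega)\rangle,$$ $$\Gamma_c' := \langle\Lambda_{\omega,c},\ \varphi' := (\omega/2,\ 2c/3+\operatorname{Im}\omega/6)\,\mu(\omega)\rangle.$$ Then the conjugacy class of $\Gamma$ in $\mathbb{H}\rtimes\mathbb{C}^*$ depends on $N$ modulo $3$ as follows. If $N\equiv0 \pmod 3$, then $\Gamma$ is conjugate in $\mathbb{H}\rtimes\mathbb{C}^*$ to either $\Gamma_c$ or $\Gamma_c'$. If $N\equiv1\pmod 3$, then $\Gamma$ is conjugate to $\Gamma_c'$. If $N\equiv2\pmod 3$, then $\Gamma$ is conjugate to $\Gamma_c$.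
   Context: The Heisenberg group is $\mathbb{H} = \mathbb{C}\times\mathbb{R}$ with multiplication $(z,t)\cdot(z',t') = (z+z', t+t'+2\operatorname{Im}(z\bar z'))$. For $\lambda \in \mathbb{C}^*$ let $\mu(\lambda)(z,t) = (\lambda z, |\lambda|^2 t)$. The group $\mathbb{H}\rtimes\mathbb{C}^*$ is the set $\mathbb{H}\times\mathbb{C}^*$ with $(g,\lambda)\cdot(h,\nu) = (g\cdot\mu(\lambda)(h), \lambda\nu)$; it acts on $\mathbb{H}$ from the left by $(g,\lambda)h = g\cdot\mu(\lambda)(h)$, and $(g,\lambda)$ is also written $g\,\mu(\lambda)$. $\mathbb{H}$ is regarded as the subgroup of elements $(g,1)$, $\mathbb{H}\rtimes S^1$ is the subgroup of elements $(g,\lambda)$ with $|\lambda|=1$, and $\mathrm{pr}_2: \mathbb{H}\rtimes\mathbb{C}^*\to\mathbb{C}^*$ is the second projection. A Heisenberg Bieberbach group is a discrete torsion-free subgroup $\Gamma\subset\mathbb{H}\rtimes S^1$ such that $\Gamma\backslash\mathbb{H}$ is compact; then $\Lambda=\Gamma\cap\mathbb{H}$ is a lattice (co-compact discrete subgroup) in $\mathbb{H}$, and $Z(\Lambda)/[\Lambda,\Lambda]$ is finite, where $Z(\Lambda)$ denotes the center and $[\Lambda,\Lambda]$ the commutator subgroup. For $\tau\in\mathbb{C}$ and $c>0$ with $4\operatorname{Im}\tau/c\in\mathbb{Z}_{>0}$, $\Lambda_{\tau,c} := \langle (1,0),(\tau,0),(0,c)\rangle \subset \mathbb{H}$; here $\tau=\omega$.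 Angle brackets denote the subgroup generated. *)

(* Defs.v *)
From HB Require Import structures.
From mathcomp Require Import all_boot all_order all_algebra.
From mathcomp Require Import finmap complex.
From mathcomp Require Import ring.
From mathcomp Require Import all_classical all_reals all_analysis.

Set Implicit Arguments.
Unset Strict Implicit.
Unset Printing Implicit Defensive.

Import Order.TTheory GRing.Theory Num.Theory.
Import numFieldNormedType.Exports.
Import Normc.

Local Open Scope classical_set_scope.
Local Open Scope complex_scope.
Local Open Scope ring_scope.

Section Groups.
Variable G : groupType.
Implicit Types A B K : set G.

Definition is_subgroup A : Prop := group_closed (mem A).

Definition generated A : set G := smallest is_subgroup A.

Definition centerg A : set G := [set x | A x /\ forall y, A y -> commute x y].

Definition commutator_subgroup A : set G :=
  generated [set [~ x, y]%g | x in A & y in A].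

Definition left_cosets A K : set (set G) :=
  [set [set (x * k)%g | k in K] | x in A].

(* The index [A : K]; [fset_set] makes it 0 when there are infinitely many cosets. *)
Definition quotient_card A K : nat := #|` fset_set (left_cosets A K) |%fset.

Definition torsion_free A : Prop :=
  forall (x : G) (n : nat), A x -> (x ^+ n.+1)%g = 1%g -> x = 1%g.

Definition conjugate_sets A B : Prop := exists g : G, [set (x ^ g)%g | x in A] = B.

End Groups.

Section NonzeroComplex.
Variable R : realType.

Record cstar : Type := CStar { cval :> R[i]; cvalP : cval != 0 }.

HB.instance Definition _ := [isSub for cval].
HB.instance Definition _ := [Choice of cstar by <:].

Fact cstar_mul_subproof (x y : cstar) : cval x * cval y != 0.
Proof. by rewrite mulf_neq0 ?cvalP. Qed.
Fact cstar_inv_subproof (x : cstar) : (cval x)^-1 != 0.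
Proof. by rewrite invr_neq0 ?cvalP. Qed.

Definition cstar_one : cstar := CStar (oner_neq0 R[i]).
Definition cstar_mul (x y : cstar) : cstar := CStar (cstar_mul_subproof x y).
Definition cstar_inv (x : cstar) : cstar := CStar (cstar_inv_subproof x).

Fact cstar_mulA : associative cstar_mul.
Proof. by move=> x y z; apply: val_inj; rewrite /= mulrA. Qed.
Fact cstar_mul1 : left_id cstar_one cstar_mul.
Proof. by move=> x; apply: val_inj; rewrite /= mul1r. Qed.
Fact cstar_mulr1 : right_id cstar_one cstar_mul.
Proof. by move=> x; apply: val_inj; rewrite /= mulr1. Qed.
Fact cstar_mulV : left_inverse cstar_one cstar_inv cstar_mul.
Proof. by move=> x; apply: val_inj; rewrite /= mulVf ?cvalP. Qed.
Fact cstar_mulrV : right_inverse cstar_one cstar_inv cstar_mul.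
Proof. by move=> x; apply: val_inj; rewrite /= mulfV ?cvalP. Qed.

HB.instance Definition _ := isGroup.Build cstar
  cstar_mulA cstar_mul1 cstar_mulr1 cstar_mulV cstar_mulrV.

HB.instance Definition _ :=
  Topological.copy cstar (initial_topology (cval : cstar -> R[i]^o)).

End NonzeroComplex.

Section Heisenberg.
Variable R : realType.

Record heis : Type := Heis { hz : R[i]; ht : R }.

Definition heis_pair (g : heis) : R[i]^o * R := (hz g, ht g).
Definition pair_heis (p : R[i]^o * R) : heis := Heis p.1 p.2.
Fact heis_pairK : cancel heis_pair pair_heis.
Proof. by case. Qed.

HB.instance Definition _ := Choice.copy heis (can_type heis_pairK).
HB.instance Definition _ := Topological.copy heis (initial_topology heis_pair).

Definition heis_one : heis := Heis 0 0.
Definition heis_mul (g h : heis) : heis :=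
  Heis (hz g + hz h) (ht g + ht h + 2 * complex.Im (hz g * ((hz h)^*)%C)).
Definition heis_inv (g : heis) : heis := Heis (- hz g) (- ht g).

Fact heis_mulA : associative heis_mul.
Proof.
move=> [[a b] s] [[c d] t] [[e f] u]; rewrite /heis_mul /=.
by congr Heis; [rewrite addrA | ring].
Qed.
Fact heis_mul1 : left_id heis_one heis_mul.
Proof.
move=> [[a b] s]; rewrite /heis_mul /=.
by congr Heis; [rewrite add0r | ring].
Qed.
Fact heis_mulr1 : right_id heis_one heis_mul.
Proof.
move=> [[a b] s]; rewrite /heis_mul /=.
by congr Heis; [rewrite addr0 | ring].
Qed.
Fact heis_mulV : left_inverse heis_one heis_inv heis_mul.
Proof.
move=> [[a b] s]; rewrite /heis_mul /=.
by congr Heis; [rewrite addNr | ring].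
Qed.
Fact heis_mulrV : right_inverse heis_one heis_inv heis_mul.
Proof.
move=> [[a b] s]; rewrite /heis_mul /=.
by congr Heis; [rewrite addrN | ring].
Qed.

HB.instance Definition _ := isGroup.Build heis
  heis_mulA heis_mul1 heis_mulr1 heis_mulV heis_mulrV.

(* [normc] is the modulus with values in [R], whereas [`|z|] lies in [R[i]]. *)
Definition mu_ (l : cstar R) (g : heis) : heis :=
  Heis (cval l * hz g) (normc l ^+ 2 * ht g).

Fact muM l : {morph mu_ l : g h / (g * h)%g}.
Proof.
move=> [[a b] s] [[c d] t]; case: l => -[x y] ?.
rewrite /mu_; congr Heis; first by rewrite /= mulrDr.
by rewrite /= sqr_sqrtr ?addr_ge0 ?sqr_ge0 //; ring.
Qed.
Fact mu_comp (l k : cstar R) g : mu_ (l * k)%g g = mu_ l (mu_ k g).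
Proof. by rewrite /mu_ /= normcM exprMn !mulrA. Qed.
Fact mu1 g : mu_ 1%g g = g.
Proof. by case: g => z t; rewrite /mu_ (normc1 R) expr1n !mul1r. Qed.

End Heisenberg.

Section SemidirectProduct.
Variable R : realType.

(* A record rather than a pair, as pairs already carry the direct product law. *)
Record heisC : Type := HeisC { pr1 : heis R; pr2 : cstar R }.

Definition heisC_pair (x : heisC) : heis R * cstar R := (pr1 x, pr2 x).
Definition pair_heisC (p : heis R * cstar R) : heisC := HeisC p.1 p.2.
Fact heisC_pairK : cancel heisC_pair pair_heisC.
Proof. by case. Qed.

HB.instance Definition _ := Choice.copy heisC (can_type heisC_pairK).
HB.instance Definition _ :=
  Topological.copy heisC (initial_topology heisC_pair).

Definition heisC_one : heisC := HeisC 1%g 1%g.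
Definition heisC_mul (x y : heisC) : heisC :=
  HeisC (pr1 x * mu_ (pr2 x) (pr1 y))%g (pr2 x * pr2 y)%g.
Definition heisC_inv (x : heisC) : heisC :=
  HeisC (mu_ (pr2 x)^-1%g (pr1 x)^-1%g) (pr2 x)^-1%g.

Fact heisC_mulA : associative heisC_mul.
Proof.
move=> x y z; rewrite /heisC_mul /=.
by rewrite muM mu_comp !mulgA.
Qed.
Fact heisC_mul1 : left_id heisC_one heisC_mul.
Proof. by move=> [g l]; rewrite /heisC_mul /= mu1 !mul1g. Qed.
Fact mug1 (l : cstar R) : mu_ l 1%g = 1%g.
Proof. by apply: (mulgI (mu_ l 1%g)); rewrite -muM !mulg1. Qed.
Fact heisC_mulr1 : right_id heisC_one heisC_mul.
Proof. by move=> [g l]; rewrite /heisC_mul /= mug1 !mulg1. Qed.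
Fact heisC_mulV : left_inverse heisC_one heisC_inv heisC_mul.
Proof. by move=> [g l]; rewrite /heisC_mul /= -muM !mulVg mug1. Qed.
Fact heisC_mulrV : right_inverse heisC_one heisC_inv heisC_mul.
Proof. by move=> [g l]; rewrite /heisC_mul /= -mu_comp !mulgV mu1 mulgV. Qed.

HB.instance Definition _ := isGroup.Build heisC
  heisC_mulA heisC_mul1 heisC_mulr1 heisC_mulV heisC_mulrV.

Definition heis_act (x : heisC) (h : heis R) : heis R := (pr1 x * mu_ (pr2 x) h)%g.

Definition of_heis (g : heis R) : heisC := HeisC g 1%g.

Definition heis_sub : set heisC := range of_heis.

Definition heisS1 : set heisC := [set x | normc (pr2 x) = 1].

End SemidirectProduct.

Section OrbitSpace.
Variables (R : realType) (Gamma : set (heisC R)).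

Definition orbit_of (h : heis R) : set (heis R) :=
  [set heis_act x h | x in Gamma].

(* Equality of orbits: an equivalence relation for any set [Gamma], and the usual
   relation [exists2 x, Gamma x & k = heis_act x h] when [Gamma] is a subgroup. *)
Definition same_orbit (h k : heis R) : bool := `[< orbit_of h = orbit_of k >].

Fact same_orbit_refl : reflexive same_orbit.
Proof. by move=> h; apply/asboolP. Qed.
Fact same_orbit_sym : symmetric same_orbit.
Proof. by move=> h k; apply/asboolP/asboolP => ->. Qed.
Fact same_orbit_trans : transitive same_orbit.
Proof. by move=> h k l /asboolP hk /asboolP kl; apply/asboolP; rewrite hk. Qed.

Canonical same_orbit_equiv :=
  EquivRel same_orbit same_orbit_refl same_orbit_sym same_orbit_trans.

Definition orbit_space : topologicalType :=
  quotient_topology {eq_quot same_orbit_equiv}%qT.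

End OrbitSpace.

Section Bieberbach.
Variable R : realType.

Record heis_bieberbach (Gamma : set (heisC R)) : Prop := HeisBieberbach {
  bieb_subgroup : is_subgroup Gamma;
  bieb_S1 : Gamma `<=` @heisS1 R;
  bieb_discrete : Gamma `<=` isolated Gamma;
  bieb_torsion_free : torsion_free Gamma;
  bieb_cocompact : compact [set: orbit_space Gamma]
}.

Definition cexp (z : R[i]) : R[i] :=
  (expR (complex.Re z))%:C * (cos (complex.Im z) +i* sin (complex.Im z)).

Fact cexp_neq0 z : cexp z != 0.
Proof.
rewrite mulf_neq0 //.
  by rewrite fmorph_eq0 gt_eqF ?expR_gt0.
apply/negP => /eqP [c0 s0].
have := cos2Dsin2 (complex.Im z); rewrite c0 s0 !expr0n addr0 => /eqP.
by rewrite eq_sym oner_eq0.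
Qed.

Definition omega : cstar R := CStar (cexp_neq0 (0 +i* (2 * pi / 3))).

Definition Lambda_ (tau : R[i]) (c : R) : set (heis R) :=
  generated [set Heis 1 0; Heis tau 0; Heis 0 c].

Definition phi_ (c : R) : heisC R :=
  HeisC (Heis (cval omega / 2) (c / 3 + complex.Im omega / 6)) omega.

Definition phi_' (c : R) : heisC R :=
  HeisC (Heis (cval omega / 2) (2 * c / 3 + complex.Im omega / 6)) omega.

Definition Gamma_ (c : R) : set (heisC R) :=
  generated (@of_heis R @` Lambda_ omega c `|` [set phi_ c]).

Definition Gamma_' (c : R) : set (heisC R) :=
  generated (@of_heis R @` Lambda_ omega c `|` [set phi_' c]).

End Bieberbach.

(* Main.v *)
Require Import Defs.
From mathcomp Require Import all_boot all_order all_algebra.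
From mathcomp Require Import finmap complex.
From mathcomp Require Import zify ring lra.
From mathcomp Require Import all_classical all_reals all_analysis.

Set Implicit Arguments.
Unset Strict Implicit.
Unset Printing Implicit Defensive.

Import Order.TTheory GRing.Theory Num.Theory.
Import numFieldNormedType.Exports.
Import Normc.

Local Open Scope classical_set_scope.
Local Open Scope complex_scope.
Local Open Scope ring_scope.

(** In the coordinates (x, y, s) of the point (x + y omega, 4 Im omega s), the
    product of (x, y, s) and (x', y', s') in the Heisenberg group is
    (x + x', y + y', s + s' + (y x' - x y') / 2), and mu (omega) maps (x, y, s) to
    (- y, x - y, s). The proof has two halves: the lattice of translations in Gamma
    can be normalized, and then the possible screw motions over omega are enumerated
    by congruences modulo 3.

    Lattice. Let g be an element of Gamma over omega. Conjugation by g rotates the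
    translations, and the commutator of a translation over p with its conjugate is
    central of height |p| ^ 2. The central translations form a discrete group, so
    they are the multiples of some c, and the squared lengths of the projections p
    are multiples of c as well; hence there is a shortest nonzero p, provided
    there is one at all, which is what cocompactness gives
    (cocompact_projection_neq0). Conjugating by mu (p) makes it 1; Euclidean
    division in Z[omega] shows that the projection of the lattice is Z[omega], and
    conjugation by a translation puts the lifts of 1 and omega at height 0
    (lattice_normal_form). The centre is then generated by 1 / N, where N is the
    index of the commutator subgroup in it, and this index is invariant under
    conjugation (normalized_quotient_card).

    Screw motions. Let g = ((x, y, s), omega) be in Gamma. As g normalizes the
    lattice, x = m / N and y = 1 / 2 + n / N with integers m, n
    (screw_denominators). Its cube is central, equal to j / N, and 3 does not
    divide j, since otherwise a central translate of g would have order 3. The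
    same applied to g (-1, 0, 0) and g (1, 0, 0) shows that 3 divides neither
    j + e nor j - e - N, where e = m + n. Conjugation by translations normalizing the
    lattice moves (m, n) by (omega - 1) Z[omega], so the planar part x + y omega
    can be put at omega / 2 exactly when 3 divides e. If 3 does not divide N, this
    is achieved by multiplying g by a lattice element, which changes e by N
    or - N; if 3 divides N, then j avoids 0, e and - e modulo 3, which forces e = 0
    (screw_class_trivial). Once e = 0, the residue of j is neither 0 nor that of
    N. The residue 1 is that of phi and the residue 2 that of phi', whence the
    three cases of the theorem (normalized_classification). *)

(** * Subgroups and injective morphisms *)

Section SubgroupTheory.
Variable G : groupType.
Implicit Types (A B K : set G) (x y g : G).

Lemma is_subgroupP A :
  is_subgroup A <-> A 1%g /\ forall x y, A x -> A y -> A (x * y^-1)%g.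
Proof.
split=> -[A1 AV]; split.
- by move: A1; rewrite inE.
- by move=> x y Ax Ay; have := AV x y; rewrite !inE; apply.
- by rewrite inE.
- by move=> x y; rewrite !inE; apply: AV.
Qed.

Lemma subgroup1 A : is_subgroup A -> A 1%g.
Proof. by case/is_subgroupP. Qed.

Lemma subgroupV A x : is_subgroup A -> A x -> A x^-1%g.
Proof. by case/is_subgroupP=> A1 AV Ax; rewrite -[_^-1%g]mul1g; apply: AV. Qed.

Lemma subgroupM A x y : is_subgroup A -> A x -> A y -> A (x * y)%g.
Proof.
move=> sA Ax Ay; rewrite -[y]invgK; case/is_subgroupP: (sA) => _; apply=> //.
exact: subgroupV.
Qed.

Lemma generated_subgroup A : is_subgroup (generated A).
Proof.
apply/is_subgroupP; split=> [B [sB _]|x y Ax Ay B AB]; first exact: subgroup1.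
by case: (AB) => sB _; case/is_subgroupP: (sB) => _; apply; [apply: Ax|apply: Ay].
Qed.

Lemma sub_generated A : A `<=` generated A.
Proof. by move=> x Ax B [_ AB]; apply: AB. Qed.

Lemma generated_min A B : is_subgroup B -> A `<=` B -> generated A `<=` B.
Proof. by move=> sB AB x; apply. Qed.

Lemma conjugate_imageP A g x : [set (y ^ g)%g | y in A] x <-> A (x ^ g^-1)%g.
Proof.
split=> [[y Ay <-]|Ax]; first by rewrite conjgK.
by exists (x ^ g^-1)%g => //; rewrite conjgKV.
Qed.

Lemma conjugate_sets_trans A B K :
  conjugate_sets A B -> conjugate_sets B K -> conjugate_sets A K.
Proof.
move=> [g <-] [h <-]; exists (g * h)%g; rewrite image_comp.
by apply: eq_imagel => x _ /=; rewrite conjgM.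
Qed.

End SubgroupTheory.

(** When A is infinite, both counts are 0. *)
Lemma card_fset_set_image (T U : choiceType) (f : T -> U) (A : set T) :
  injective f -> #|` fset_set (f @` A)|%fset = #|` fset_set A|%fset.
Proof.
move=> finj; have [finA|infA] := pselect (finite_set A).
  by rewrite fset_set_image // card_imfset.
rewrite /fset_set; case: pselect => // finfA; last by case: pselect.
case: infA; have -> : A = f @^-1` (f @` A).
  by apply/seteqP; split=> [x Ax|x [y Ay /finj <-]] //; exists x.
by apply: finite_preimage finfA => x y _ _; apply: finj.
Qed.

(** The index defining N is computed after a conjugation and inside the Heisenberg
    group rather than in the semidirect product; both changes of viewpoint are
    injective morphisms, along which centre, commutator subgroup and index are
    transported here. *)
Section InjectiveMorphism.
Variables (G H : groupType) (f : G -> H).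
Hypotheses (fM : {morph f : x y / (x * y)%g}) (finj : injective f).
Implicit Types A K : set G.

Let f1 : f 1%g = 1%g.
Proof. by apply: (mulgI (f 1%g)); rewrite -fM !mulg1. Qed.

Let fV x : f x^-1%g = (f x)^-1%g.
Proof. by apply: (mulgI (f x)); rewrite -fM !mulgV. Qed.

Lemma image_subgroup A : is_subgroup A -> is_subgroup (f @` A).
Proof.
case/is_subgroupP=> A1 AV; apply/is_subgroupP; split; first by exists 1%g.
by move=> _ _ [x Ax <-] [y Ay <-]; exists (x * y^-1)%g; [apply: AV|rewrite fM fV].
Qed.

Lemma preimage_subgroup (B : set H) : is_subgroup B -> is_subgroup (f @^-1` B).
Proof.
move=> sB; apply/is_subgroupP; split=> [|x y Bx By] /=.
  by rewrite f1; apply: subgroup1.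
by rewrite fM fV; apply: subgroupM => //; apply: subgroupV.
Qed.

Lemma image_generated A : f @` generated A = generated (f @` A).
Proof.
apply/seteqP; split=> [_ [x Ax <-]|]; last first.
  apply: generated_min; first exact/image_subgroup/generated_subgroup.
  by apply: image_subset; apply: sub_generated.
apply: (Ax (f @^-1` generated (f @` A))); split.
  exact/preimage_subgroup/generated_subgroup.
by move=> y Ay; apply: sub_generated; exists y.
Qed.

Lemma image_centerg A : centerg (f @` A) = f @` centerg A.
Proof.
apply/seteqP; split=> [_ [[x Ax <-] cx]|_ [x [Ax cx] <-]].
  exists x => //; split=> // y Ay; apply: finj; rewrite !fM.
  by apply: cx; exists y.
split; first by exists x.
by move=> _ [y Ay <-]; rewrite /commute -!fM cx.
Qed.

Lemma image_commutator_subgroup A :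
  commutator_subgroup (f @` A) = f @` commutator_subgroup A.
Proof.
rewrite /commutator_subgroup image_generated; congr generated.
apply/seteqP; split=> [_ [_ [x Ax <-] [_ [y Ay <-] <-]]|_ [_ [x Ax [y Ay <-]] <-]].
  by exists [~ x, y]%g; [exists x => //; exists y|rewrite !commgEl !conjgE !fM !fV].
exists (f x); first by exists x.
by exists (f y); [exists y|rewrite !commgEl !conjgE !fM !fV].
Qed.

Lemma quotient_card_image A K :
  quotient_card (f @` A) (f @` K) = quotient_card A K.
Proof.
have -> : quotient_card (f @` A) (f @` K) =
    #|` fset_set [set [set f x | x in B] | B in left_cosets A K]|%fset.
  congr (#|` fset_set _|%fset); rewrite /left_cosets !image_comp.
  apply: eq_imagel => x _ /=; rewrite !image_comp.
  by apply: eq_imagel => k _ /=; rewrite fM.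
apply: card_fset_set_image => B C BC; apply/seteqP.
by split=> x Bx; [rewrite -(image_inj finj) -BC|rewrite -(image_inj finj) BC];
  exists x.
Qed.

End InjectiveMorphism.

(** * Eisenstein coordinates on the Heisenberg group *)

(** The squared modulus of x + y omega. *)
Local Notation eis_norm x y := (x ^+ 2 - x * y + y ^+ 2).

Section EisensteinCoordinates.
Variable R : realType.
Implicit Types (x y s t : R) (g : heis R).

Local Notation h := (complex.Im (cval (omega R))).

(** Since pi / 3 and its double add up to pi, a = cos (pi / 3) is a root of
    2 a ^ 2 - 1 = - a; the positive root is 1 / 2. *)
Lemma cos_2pi3 : cos (2 * pi / 3) = - 2^-1 :> R.
Proof.
have cospi3_gt0 : 0 < cos (pi / 3 : R).
  apply: cos_gt0_pihalf; have := pi_gt0 R; lra.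
have e1 : cos (2 * pi / 3) = 2 * cos (pi / 3) ^+ 2 - 1 :> R.
  have -> : 2 * pi / 3 = (pi / 3) *+ 2 :> R by rewrite mulr2n; ring.
  by rewrite cos_mulr2n mulr2n; ring.
have e2 : cos (2 * pi / 3) = - cos (pi / 3) :> R.
  have -> : 2 * pi / 3 = - (pi / 3) + pi :> R by field.
  by rewrite cosDpi cosN.
have : (2 * cos (pi / 3 : R) - 1) * (cos (pi / 3) + 1) = 0.
  by rewrite e2 in e1; nra.
move/eqP; rewrite mulf_eq0 => /orP[] /eqP; lra.
Qed.

Lemma sin_2pi3_gt0 : 0 < sin (2 * pi / 3) :> R.
Proof. by apply: sin_gt0_pi; have := pi_gt0 R; lra. Qed.

Lemma omegaE : cval (omega R) = (- 2^-1) +i* h.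
Proof.
by rewrite /omega /cexp /= expR0 cos_2pi3; simpc.
Qed.

Lemma im_omega_gt0 : 0 < h.
Proof. by rewrite /omega /cexp /= expR0; simpc; rewrite sin_2pi3_gt0. Qed.

Lemma im_omega_sqr : h * h = 3 / 4.
Proof.
have -> : h = sin (2 * pi / 3) by rewrite /omega /cexp /= expR0; simpc.
have := cos2Dsin2 (2 * pi / 3 : R); rewrite cos_2pi3 !expr2; lra.
Qed.

Lemma im_omega_neq0 : h != 0.
Proof. by rewrite gt_eqF ?im_omega_gt0. Qed.

Lemma normc_omega : normc (omega R) = 1.
Proof.
rewrite omegaE; move: (h) im_omega_sqr => k kk.
by rewrite /= -[RHS]sqrtr1 !expr2 kk; congr Num.sqrt; field.
Qed.

Lemma omega_expg3 : (omega R * (omega R * omega R))%g = 1%g.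
Proof.
apply: val_inj; change (cval (omega R) * (cval (omega R) * cval (omega R)) = 1).
rewrite omegaE; move: (h) im_omega_sqr => k kk.
apply/eqP; rewrite eq_complex /=; apply/andP; split; apply/eqP; last first.
  by transitivity (k * (3 / 4 - k * k)); [field|rewrite kk; field].
by transitivity (3 / 2 * (k * k) - 8^-1); [field|rewrite kk; field].
Qed.

Lemma omega_neq1 : omega R <> 1%g.
Proof.
move=> /(congr1 (fun z : cstar R => complex.Im (cval z))) /= /eqP.
by rewrite (negPf im_omega_neq0).
Qed.

(** The height is measured in units of 4 Im omega, the commutator of 1 and omega:
    in these coordinates the group law and the action of omega have rational
    coefficients, and the central element of height c = 4 Im omega / N is 1 / N. *)
Definition eis x y s : heis R := Heis ((x - y / 2) +i* (y * h)) (4 * h * s).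

Lemma eis_ex g : exists x y s, g = eis x y s.
Proof.
case: g => [[a b] t]; exists (a + b / h / 2), (b / h), (t / (4 * h)).
by rewrite /eis; congr Heis; [congr Complex|]; field; rewrite im_omega_neq0.
Qed.

Lemma eis_inj x y s x' y' s' :
  eis x y s = eis x' y' s' -> [/\ x = x', y = y' & s = s'].
Proof.
have h0 := im_omega_neq0.
have h40 : 4 * h != 0 by rewrite mulf_neq0 // pnatr_eq0.
move=> [xE /(mulIf h0) yE /(mulfI h40) sE]; split=> //.
by rewrite yE in xE; apply: addIr xE.
Qed.

Lemma eisM x y s x' y' s' : (eis x y s * eis x' y' s')%g =
  eis (x + x') (y + y') (s + s' + (y * x' - x * y') / 2).
Proof.
rewrite [LHS]/(heis_mul _ _) /heis_mul /eis; move: (h) => k /=.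
by congr Heis; [congr Complex|]; field.
Qed.

Lemma eis1 : eis 0 0 0 = 1%g.
Proof.
by rewrite [RHS]/(heis_one R) /heis_one /eis; congr Heis; [congr Complex|]; ring.
Qed.

Lemma eisV x y s : ((eis x y s)^-1)%g = eis (- x) (- y) (- s).
Proof.
apply: (mulgI (eis x y s)); rewrite mulgV eisM -eis1.
by congr eis; ring.
Qed.

Lemma eisJ x y s x' y' s' : (eis x y s ^ eis x' y' s')%g =
  eis x y (s + (y * x' - x * y')).
Proof. by rewrite conjgE eisV !eisM; congr eis; field. Qed.

Lemma eisR x y s x' y' s' : ([~ eis x y s, eis x' y' s'])%g =
  eis 0 0 (y * x' - x * y').
Proof. by rewrite commgEl eisJ eisV eisM; congr eis; field. Qed.

Lemma mu_omega_eis x y s : mu_ (omega R) (eis x y s) = eis (- y) (x - y) s.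
Proof.
rewrite /mu_ normc_omega expr1n mul1r /eis omegaE; congr Heis.
move: (h) im_omega_sqr => k kk /=; congr Complex; last by field.
by rewrite mulrCA kk; field.
Qed.

Lemma hz_eis_eq0 x y s : hz (eis x y s) = 0 -> x = 0 /\ y = 0.
Proof.
move=> [xE /eqP]; rewrite mulf_eq0 (negPf im_omega_neq0) orbF => /eqP yE.
by split=> //; rewrite yE mul0r subr0 in xE.
Qed.

Lemma subgroup_eis_zmul (A : set (heis R)) (k : int) x y s :
  is_subgroup A -> A (eis x y s) -> A (eis (k%:~R * x) (k%:~R * y) (k%:~R * s)).
Proof.
move=> sA Axys; elim/int_ind: k => [|n IHn|n IHn].
- by rewrite !mul0r eis1; apply: subgroup1.
- have -> : eis (n.+1%:~R * x) (n.+1%:~R * y) (n.+1%:~R * s) =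
      (eis (n%:~R * x) (n%:~R * y) (n%:~R * s) * eis x y s)%g.
    by rewrite eisM -[n.+1]addn1 PoszD rmorphD /=; congr eis; field.
  exact: subgroupM.
- have -> : eis ((- n.+1%:Z)%:~R * x) ((- n.+1%:Z)%:~R * y)
                ((- n.+1%:Z)%:~R * s) =
      (eis ((- n%:Z)%:~R * x) ((- n%:Z)%:~R * y) ((- n%:Z)%:~R * s) *
       (eis x y s)^-1)%g.
    rewrite eisV eisM -[n.+1]addn1 PoszD opprD rmorphD /=.
    by congr eis; field.
  by apply: subgroupM => //; apply: subgroupV.
Qed.

Lemma of_heisM : {morph @of_heis R : g g' / (g * g')%g}.
Proof.
move=> g g'; rewrite /of_heis [RHS]/(heisC_mul _ _) /heisC_mul /=.
by rewrite mu1 mulg1.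
Qed.

Lemma of_heis_inj : injective (@of_heis R).
Proof. by move=> g g' []. Qed.

Lemma of_heisV g : of_heis g^-1%g = (of_heis g)^-1%g.
Proof. by apply: (mulgI (of_heis g)); rewrite -of_heisM !mulgV. Qed.

Lemma of_heisJ g g' : of_heis (g ^ g')%g = (of_heis g ^ of_heis g')%g.
Proof. by rewrite !conjgE !of_heisM of_heisV. Qed.

Lemma heisC_mulE g g' (l l' : cstar R) :
  (HeisC g l * HeisC g' l')%g = HeisC (g * mu_ l g')%g (l * l')%g.
Proof. by []. Qed.

Lemma heisC_conj_of_heis g g' l :
  (HeisC g l * of_heis g')%g = (of_heis (mu_ l g' ^ g^-1)%g * HeisC g l)%g.
Proof.
rewrite /of_heis !heisC_mulE mulg1 mul1g mu1 conjgE invgK; congr HeisC.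
by rewrite -mulgA mulgVK.
Qed.

(** Being central, the cube is unchanged under conjugation by translations; modulo
    the cubes of central lattice elements, it is the invariant that tells the two
    groups of the theorem apart. *)
Lemma omega_cube x y s :
  let g := HeisC (eis x y s) (omega R) in
  (g ^+ 3)%g = of_heis (eis 0 0 (3 * s - eis_norm x y / 2)).
Proof.
rewrite /= !expgS expg0 mulg1 !heisC_mulE omega_expg3 /of_heis; congr HeisC.
by rewrite !(mu_omega_eis, eisM); congr eis; field.
Qed.

End EisensteinCoordinates.

(** * The standard lattice and its index *)

Section HeisenbergLattice.
Variable R : realType.
Implicit Types (x y s t : R) (g : heis R).

(** The elements (1, 0, 0) ^ k (0, 1, 0) ^ l (0, 0, 1 / N) ^ j; for c = 4 Im omega / N
    these make up the group generated by (1, 0), (omega, 0) and (0, c). *)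
Definition heis_lattice (N : nat) : set (heis R) :=
  [set g | exists k l j : int,
    g = eis k%:~R l%:~R (j%:~R / N%:R - k%:~R * l%:~R / 2)].

Lemma heis_lattice_min N (A : set (heis R)) :
  is_subgroup A -> A (eis 1 0 0) -> A (eis 0 1 0) -> A (eis 0 0 N%:R^-1) ->
  heis_lattice N `<=` A.
Proof.
move=> sA A1 A2 A3 _ [k [l [j ->]]].
have -> : eis k%:~R l%:~R (j%:~R / N%:R - k%:~R * l%:~R / 2) =
   (eis (k%:~R * 1) (k%:~R * 0) (k%:~R * 0) *
    eis (l%:~R * 0) (l%:~R * 1) (l%:~R * 0) *
    eis (j%:~R * 0) (j%:~R * 0) (j%:~R * N%:R^-1))%g :> heis R.
  by rewrite !eisM; congr eis; ring.
by do 2?[apply: subgroupM => //]; apply: subgroup_eis_zmul.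
Qed.

Lemma eis_lattice1 N : heis_lattice N (eis 1 0 0).
Proof. by exists 1, 0, 0; congr eis; ring. Qed.

Lemma eis_lattice2 N : heis_lattice N (eis 0 1 0).
Proof. by exists 0, 1, 0; congr eis; ring. Qed.

Lemma eis_lattice_central N (j : int) : heis_lattice N (eis 0 0 (j%:~R / N%:R)).
Proof. by exists 0, 0, j; congr eis; ring. Qed.

Lemma centerg_heis_lattice N :
  centerg (heis_lattice N) = [set eis 0 0 (j%:~R / N%:R) | j in [set: int]].
Proof.
apply/seteqP; split=> [_ [[k [l [j ->]]] cg]|_ [j _ <-]].
  have /commgP := cg _ (eis_lattice1 N).
  have /commgP := cg _ (eis_lattice2 N).
  rewrite !eisR -eis1 => /eqP /eis_inj[_ _ k0] /eqP /eis_inj[_ _ l0].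
  exists j => //; congr eis; try lra.
  have -> : k%:~R = 0 :> R by lra.
  by rewrite !mul0r subr0.
split; first exact: eis_lattice_central.
by move=> _ [k [l [i ->]]]; apply/commgP/eqP; rewrite eisR -eis1; congr eis; ring.
Qed.

Lemma commutator_heis_lattice N :
  commutator_subgroup (heis_lattice N) = [set eis 0 0 j%:~R | j in [set: int]].
Proof.
apply/seteqP; split.
  apply: generated_min.
    apply/is_subgroupP; split; first by exists 0; rewrite ?eis1.
    move=> _ _ [j _ <-] [i _ <-]; exists (j - i) => //.
    by rewrite eisV eisM rmorphB; congr eis; ring.
  move=> _ [_ [k [l [j ->]]] [_ [k' [l' [j' ->]]] <-]].
  by exists (l * k' - k * l') => //; rewrite eisR rmorphB !rmorphM.
move=> _ [j _ <-].
have -> : eis 0 0 j%:~R = eis (j%:~R * 0) (j%:~R * 0) (j%:~R * 1) :> heis R.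
  by congr eis; ring.
apply: (subgroup_eis_zmul (A := commutator_subgroup _)).
  exact: generated_subgroup.
apply: sub_generated; exists (eis 0 1 0); first exact: eis_lattice2.
exists (eis 1 0 0); first exact: eis_lattice1.
by rewrite eisR; congr eis; ring.
Qed.

Lemma quotient_card_heis_lattice N : (0 < N)%N ->
  quotient_card (centerg (heis_lattice N)) (commutator_subgroup (heis_lattice N))
  = N.
Proof.
move=> N0; rewrite centerg_heis_lattice commutator_heis_lattice.
have NZ0 : N%:Z != 0 by rewrite eqz_nat -lt0n.
have NR0 : N%:R != 0 :> R by rewrite pnatr_eq0 -lt0n.
pose K := [set eis 0 0 j%:~R | j in [set: int]] : set (heis R).
pose coset (i : nat) := [set (eis 0 0 (i%:R / N%:R) * k)%g | k in K].
rewrite /quotient_card; apply: card_fset_set.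
have -> : left_cosets [set eis 0 0 (j%:~R / N%:R) | j in [set: int]] K =
    coset @` `I_N.
  apply/seteqP; split=> [_ [_ [j _ <-] <-]|_ [i _ <-]]; last first.
    by exists (eis 0 0 (i%:~R / N%:R)) => //; exists i%:Z.
  (* Modulo the integers, a multiple of 1 / N is i / N for a unique i < N. *)
  exists `|(j %% N)%Z|%N.
    by rewrite /= -ltz_nat gez0_abs ?modz_ge0 ?ltz_pmod.
  have jE : j%:~R / N%:R = (`|(j %% N)%Z|%N)%:R / N%:R + (j %/ N)%Z%:~R :> R.
    rewrite {1}(divz_eq j N) -[(`|_|%N)%:R]/((`|_|%N)%:~R) gez0_abs ?modz_ge0 //.
    by rewrite rmorphD rmorphM /=; field.
  apply/seteqP; split=> _ [_ [i _ <-] <-].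
    exists (eis 0 0 (i - (j %/ N)%Z)%:~R); first by exists (i - (j %/ N)%Z).
    by rewrite !eisM jE rmorphB; congr eis; ring.
  exists (eis 0 0 (i + (j %/ N)%Z)%:~R); first by exists (i + (j %/ N)%Z).
  by rewrite !eisM jE rmorphD; congr eis; ring.
apply: inj_card_eq => i i' /set_mem /= iN /set_mem /= i'N ii'.
have : coset i (eis 0 0 (i%:R / N%:R)).
  by exists (eis 0 0 0); [exists 0|rewrite eisM; congr eis; ring].
rewrite ii' => -[_ [j _ <-]]; rewrite eisM => /eis_inj[_ _ /eqP].
rewrite -(inj_eq (mulIf NR0)) => /eqP e.
have : ((i'%:Z + j * N%:Z)%:~R : R) = i%:Z%:~R.
  rewrite rmorphD rmorphM /= -!pmulrn; move: e.
  by rewrite !mul0r subr0 mul0r addr0 mulrDl !mulfVK.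
move=> /intr_inj {}e; have [j0|j0|j0] := ltgtP j 0; last first.
- by move: e; rewrite j0; lia.
- have : j * N%:Z <= - N%:Z by nia.
  lia.
- have : N%:Z <= j * N%:Z by nia.
  lia.
Qed.

End HeisenbergLattice.

(** * Groups with holonomy generated by omega *)

Section ScrewGroups.
Variable R : realType.
Implicit Types (x y s t : R) (g : heis R) (Gamma : set (heisC R)).

Local Notation h := (complex.Im (cval (omega R))).

Lemma generated_omega (l : cstar R) : generated [set omega R] l ->
  [\/ l = 1, l = omega R | l = omega R * omega R]%g.
Proof.
pose A := [set l : cstar R | [\/ l = 1, l = omega R | l = omega R * omega R]%g].
apply: (generated_min (B := A)); last by move=> _ ->; apply: Or32.
have o3 := omega_expg3 R; have o4 : (omega R * omega R * omega R)%g = 1%g.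
  by rewrite -mulgA.
have oV : (omega R)^-1%g = (omega R * omega R)%g.
  by apply: (mulgI (omega R)); rewrite mulgV o3.
have ooV : (omega R * omega R)^-1%g = omega R.
  by apply: (mulgI (omega R * omega R)%g); rewrite mulgV o4.
apply/is_subgroupP; split; first exact: Or31.
move=> _ _ [->|->|->] [->|->|->];
  rewrite /A /= ?invg1 ?oV ?ooV ?mul1g ?mulg1 ?o3 ?o4;
  try by [apply: Or31|apply: Or32|apply: Or33].
by apply: Or32; rewrite -mulgA o3 mulg1.
Qed.

(** The algebraic content of a Bieberbach group with holonomy generated by omega. *)
Definition screw_group Gamma :=
  [/\ is_subgroup Gamma, torsion_free Gamma
    & @pr2 R @` Gamma = generated [set omega R]].

Lemma screw_group_ex Gamma : screw_group Gamma ->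
  exists x y s, Gamma (HeisC (eis x y s) (omega R)).
Proof.
move=> [_ _ pr2G]; have : generated [set omega R] (omega R).
  exact: sub_generated.
rewrite -pr2G => -[[g l] /= Gg lo]; have [x [y [s gE]]] := eis_ex g.
by exists x, y, s; rewrite -gE -lo.
Qed.

Lemma of_heis_pr1 (x : heisC R) : pr2 x = 1%g -> x = of_heis (pr1 x).
Proof. by case: x => g l /= ->. Qed.

Lemma pr2M (x y : heisC R) : pr2 (x * y)%g = (pr2 x * pr2 y)%g.
Proof. by []. Qed.

Lemma pr2V (x : heisC R) : pr2 x^-1%g = (pr2 x)^-1%g.
Proof. by []. Qed.

Lemma screw_group_cosets Gamma (phi x : heisC R) :
  screw_group Gamma -> Gamma phi -> pr2 phi = omega R -> Gamma x ->
  exists g (n : nat), Gamma (of_heis g) /\ x = (of_heis g * phi ^+ n)%g.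
Proof.
move=> [sG _ pr2G] Gphi pphi Gx.
have Gphin n : Gamma (phi ^+ n)%g.
  elim: n => [|n IHn]; first by rewrite expg0; apply: subgroup1.
  by rewrite expgS; apply: subgroupM.
suff [n pn] : exists n, pr2 x = pr2 (phi ^+ n)%g.
  have xE : (x / phi ^+ n)%g = of_heis (pr1 (x / phi ^+ n)%g).
    by apply: of_heis_pr1; rewrite pr2M pr2V pn mulgV.
  exists (pr1 (x / phi ^+ n)%g), n; rewrite -xE; split; last by rewrite mulgVK.
  by apply: subgroupM => //; apply: subgroupV.
have /generated_omega[->|->|->] : generated [set omega R] (pr2 x).
  by rewrite -pr2G; exists x.
- by exists 0.
- by exists 1; rewrite expg1.
- by exists 2; rewrite !expgS expg0 mulg1 pr2M pphi.
Qed.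

Lemma pr2J (x w : heisC R) : pr2 (x ^ w)%g = pr2 x.
Proof.
apply: val_inj.
change ((cval (pr2 w))^-1 * (cval (pr2 x) * cval (pr2 w)) = cval (pr2 x)).
by rewrite mulrCA mulVf ?mulr1 ?cvalP.
Qed.

Lemma conj_screw_group Gamma (w : heisC R) :
  screw_group Gamma -> screw_group [set (x ^ w)%g | x in Gamma].
Proof.
move=> [sG tG pr2G]; split.
- apply: image_subgroup => // x y; exact: conjMg.
- move=> _ n [x Gx <-]; rewrite -conjXg => /eqP; rewrite conjg_eq1 => /eqP xn.
  by rewrite (tG x n) ?conj1g.
- by rewrite image_comp -pr2G; apply: eq_imagel => x _; apply: pr2J.
Qed.

(** Torsion-freeness enters the classification only through this consequence. *)
Lemma screw_cube_neq0 Gamma x y s :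
  screw_group Gamma -> Gamma (HeisC (eis x y s) (omega R)) ->
  3 * s - eis_norm x y / 2 <> 0.
Proof.
move=> [_ tG _] Gg e; apply: (@omega_neq1 R).
by have /(congr1 (@pr2 R)) := tG _ 2%N Gg (etrans (omega_cube x y s)
  (etrans (congr1 (fun t => of_heis (eis 0 0 t)) e) (congr1 _ (eis1 R)))).
Qed.

(** Once the translations form the standard lattice, an element over omega is
    described by three integers m, n, j: it translates the plane by x + y omega with
    x = m / N and y = 1 / 2 + n / N, and its cube is the central element j / N. *)
Section Normalized.
Variables (N : nat) (Gamma : set (heisC R)).
Hypotheses (N0 : (0 < N)%N) (sG : screw_group Gamma).
Hypothesis LG : @of_heis R @^-1` Gamma = heis_lattice N.

Let NR0 : N%:R != 0 :> R. Proof. by rewrite pnatr_eq0 -lt0n. Qed.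

Let subG : is_subgroup Gamma. Proof. by case: sG. Qed.

Let latticeG g : Gamma (of_heis g) <-> heis_lattice N g.
Proof. by rewrite -LG. Qed.

Let central_lattice s : heis_lattice N (eis 0 0 s) ->
  exists j : int, s = j%:~R / N%:R.
Proof.
move=> [k [l [j /eis_inj[/esym/eqP k0 /esym/eqP l0 ->]]]]; exists j.
by rewrite (eqP k0) mul0r mul0r subr0.
Qed.

(** Conjugation by the given element must map (1, 0, 0) and (0, 1, 0) into the
    lattice, which bounds the denominators of x and y. The shift of y by 1 / 2 comes
    from omega ^ 2 = - 1 - omega: the lattice point (-1, 0, 0) (0, -1, 0) above it
    has height - 1 / 2. *)
Lemma screw_denominators x y s :
  Gamma (HeisC (eis x y s) (omega R)) ->
  exists m n j : int, [/\ x = m%:~R / N%:R, y = 2^-1 + n%:~R / N%:R &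
    3 * s - eis_norm x y / 2 = j%:~R / N%:R].
Proof.
move=> Gg; set gam := HeisC _ _ in Gg.
have conjG g : heis_lattice N g ->
    heis_lattice N (mu_ (omega R) g ^ (eis x y s)^-1)%g.
  move=> /latticeG Lg; apply/latticeG.
  have : Gamma (gam * of_heis g * gam^-1)%g.
    by apply: (subgroupM subG); [apply: (subgroupM subG)|apply: (subgroupV subG)].
  by rewrite heisC_conj_of_heis mulgK.
have latticeM g g' : heis_lattice N g -> heis_lattice N g' ->
    heis_lattice N (g * g')%g.
  move=> /latticeG Lg /latticeG Lg'; apply/latticeG.
  by rewrite of_heisM; apply: (subgroupM subG).
have [m xE] : exists m : int, x = m%:~R / N%:R.
  have L1 : heis_lattice N (eis 0 1 (- x)).
    have := conjG _ (eis_lattice1 R N); rewrite mu_omega_eis eisV eisJ.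
    by congr (heis_lattice N (eis _ _ _)); ring.
  have L1' : heis_lattice N (eis 0 (-1) 0 : heis R).
    by exists 0, (-1), 0; congr eis; ring.
  have : heis_lattice N (eis 0 0 (- x)).
    have := latticeM _ _ L1 L1'; rewrite eisM.
    by congr (heis_lattice N (eis _ _ _)); ring.
  by case/central_lattice=> m mE; exists (- m); rewrite rmorphN mulNr -mE opprK.
have [n yE] : exists n : int, y - x - 2^-1 = n%:~R / N%:R.
  have L2 : heis_lattice N (eis (-1) (-1) (x - y)).
    have := conjG _ (eis_lattice2 R N); rewrite mu_omega_eis eisV eisJ.
    by congr (heis_lattice N (eis _ _ _)); ring.
  have L2' : heis_lattice N (eis 1 1 (- 2^-1) : heis R).
    by exists 1, 1, 0; congr eis; field.
  have : heis_lattice N (eis 0 0 (x - y - 2^-1)).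
    have := latticeM _ _ L2 L2'; rewrite eisM.
    by congr (heis_lattice N (eis _ _ _)); ring.
  case/central_lattice=> n nE; exists (- n - N%:Z).
  rewrite rmorphB rmorphN /= mulrBl mulNr -nE -pmulrn mulfV //.
  by lra.
have : heis_lattice N (eis 0 0 (3 * s - eis_norm x y / 2)).
  apply/latticeG; rewrite -omega_cube !expgS expg0 mulg1.
  by do 2?apply: subgroupM.
case/central_lattice=> j jE; exists m, (n + m), j; split=> //.
by rewrite rmorphD mulrDl -yE -xE; ring.
Qed.

Let screw_mul_central x y s (i : int) :
  Gamma (HeisC (eis x y s) (omega R)) ->
  Gamma (HeisC (eis x y (s + i%:~R / N%:R)) (omega R)).
Proof.
move=> Gg; have := eis_lattice_central R N i => /latticeG Li.
have := subgroupM subG Gg Li; rewrite /of_heis heisC_mulE mu_omega_eis eisM mulg1.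
by congr (Gamma (HeisC (eis _ _ _) _)); field.
Qed.

Let screw_mul_eis1 x y s :
  Gamma (HeisC (eis x y s) (omega R)) ->
  Gamma (HeisC (eis x (y + 1) (s - x / 2)) (omega R)).
Proof.
move=> Gg; have := eis_lattice1 R N => /latticeG L1.
have := subgroupM subG Gg L1; rewrite /of_heis heisC_mulE mu_omega_eis eisM mulg1.
by congr (Gamma (HeisC (eis _ _ _) _)); field.
Qed.

Let screw_mul_eis1V x y s :
  Gamma (HeisC (eis x y s) (omega R)) ->
  Gamma (HeisC (eis x (y - 1) (s + x / 2)) (omega R)).
Proof.
move=> Gg; have := eis_lattice1 R N => /latticeG /(subgroupV subG) L1.
have := subgroupM subG Gg L1; rewrite -of_heisV eisV /of_heis heisC_mulE.
rewrite mu_omega_eis eisM mulg1.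
by congr (Gamma (HeisC (eis _ _ _) _)); field.
Qed.

(** If the cube were three times a central lattice element, dividing the latter out
    would leave an element of Gamma with trivial cube. *)
Let cube_not_div3 x y s (j : int) :
  Gamma (HeisC (eis x y s) (omega R)) ->
  3 * s - eis_norm x y / 2 = j%:~R / N%:R -> ~~ (3 %| j)%Z.
Proof.
move=> Gg e; apply/negP => /dvdzP[i jE].
have := screw_cube_neq0 sG (screw_mul_central (- i) Gg); apply.
rewrite mulrDr addrAC e jE !rmorphM rmorphN /=; field.
exact: NR0.
Qed.

(** The three conditions say that the cubes of the element itself and of its products
    with (-1, 0, 0) and (1, 0, 0) are not divisible by 3 in the centre. *)
Lemma screw_torsion_free_congruences x y s (m n j : int) :
  Gamma (HeisC (eis x y s) (omega R)) ->
  x = m%:~R / N%:R -> y = 2^-1 + n%:~R / N%:R ->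
  3 * s - eis_norm x y / 2 = j%:~R / N%:R ->
  [/\ ~~ (3 %| j)%Z, ~~ (3 %| j + (m + n))%Z & ~~ (3 %| j - (m + n) - N%:Z)%Z].
Proof.
move=> Gg xE yE e; split; first exact: cube_not_div3 Gg e.
all: have jE : j%:~R = (3 * s - eis_norm x y / 2) * N%:R by
  rewrite e mulfVK.
- apply: (cube_not_div3 (screw_mul_eis1V Gg)).
  by rewrite !rmorphD /= jE yE xE; field.
- apply: (cube_not_div3 (screw_mul_eis1 Gg)).
  by rewrite !rmorphB rmorphD /= jE yE xE -pmulrn; field.
Qed.

(** The residue of m + n modulo 3 is the obstruction to conjugating the planar part
    of the element to omega / 2. Multiplying by (1, 0, 0) or its inverse changes m +
    n by N or - N, so the obstruction can be removed when 3 does not divide N; when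
    3 divides N the congruences above say that j avoids 0, e and - e modulo 3, with
    e = m + n, which is possible only for e = 0. *)
Lemma screw_class_trivial : exists x y s (m n : int),
  [/\ Gamma (HeisC (eis x y s) (omega R)), x = m%:~R / N%:R,
      y = 2^-1 + n%:~R / N%:R & (3 %| m + n)%Z].
Proof.
have [x [y [s Gg]]] := screw_group_ex sG.
have [m [n [j [xE yE jE]]]] := screw_denominators Gg.
have [j0 j1 j2] := screw_torsion_free_congruences Gg xE yE jE.
have [d|d|d] : [\/ (3 %| m + n)%Z, (3 %| m + (n + N%:Z))%Z
                 | (3 %| m + (n - N%:Z))%Z].
  have [e0|e0] := boolP (3 %| m + n)%Z; first exact: Or31.
  have [e1|e1] := boolP (3 %| m + (n + N%:Z))%Z; first exact: Or32.
  by apply: Or33; lia.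
- by exists x, y, s, m, n.
- exists x, (y + 1), (s - x / 2), m, (n + N%:Z); split=> //.
    exact: screw_mul_eis1.
  by rewrite yE rmorphD /= -pmulrn; field.
- exists x, (y - 1), (s + x / 2), m, (n - N%:Z); split=> //.
    exact: screw_mul_eis1V.
  by rewrite yE rmorphB /= -pmulrn; field.
Qed.

(** A central translation reduces j to its residue modulo 3; here m = n = 0, and
    1 / 24 is the height for which the cube vanishes. *)
Lemma centered_screw_ex s : Gamma (HeisC (eis 0 2^-1 s) (omega R)) ->
  exists r : int, [/\ r = 1 \/ r = 2, ~~ (3 %| r - N%:Z)%Z &
    Gamma (HeisC (eis 0 2^-1 (r%:~R / (3 * N%:R) + 24^-1)) (omega R))].
Proof.
move=> Gg.
have [m [n [j [xE yE jE]]]] := screw_denominators Gg.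
have m0 : 0 = (0 : int)%:~R / N%:R :> R by rewrite mul0r.
have n0 : 2^-1 = 2^-1 + (0 : int)%:~R / N%:R :> R by rewrite mul0r addr0.
have [j0 _ jN] := screw_torsion_free_congruences Gg m0 n0 jE.
have [i [r [r12 jr]]] : exists i r : int, (r = 1 \/ r = 2) /\ j = r + 3 * i.
  exists (j %/ 3)%Z, (j %% 3)%Z; lia.
exists r; split=> //; first by lia.
have := screw_mul_central (- i) Gg; congr (Gamma (HeisC (eis _ _ _) _)).
have -> : s = (j%:~R / N%:R + 8^-1) / 3 by rewrite -jE; field.
by rewrite jr rmorphD rmorphM rmorphN /=; field.
Qed.

Lemma screw_group_generated (c : R) (phi : heisC R) : c = 4 * h / N%:R ->
  Gamma phi -> pr2 phi = omega R ->
  Gamma = generated (@of_heis R @` Lambda_ (omega R) c `|` [set phi]).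
Proof.
move=> cE Gphi pphi.
have e1 : eis 1 0 0 = Heis 1 0 :> heis R.
  by rewrite /eis; congr Heis; [congr Complex|]; ring.
have e2 : eis 0 1 0 = Heis (omega R) 0 :> heis R.
  by rewrite /eis omegaE; congr Heis; [congr Complex|]; ring.
have e3 : eis 0 0 N%:R^-1 = Heis 0 c :> heis R.
  by rewrite /eis cE; congr Heis; congr Complex; ring.
apply/seteqP; split=> [x Gx|]; last first.
  apply: generated_min => // x [[g Lg <-]|-> //].
  apply: (Lg (@of_heis R @^-1` Gamma)); split.
    by apply: preimage_subgroup => //; apply: of_heisM.
  rewrite LG => _ [[->|->]|->]; rewrite -?e1 -?e2 -?e3.
  - exact: eis_lattice1.
  - exact: eis_lattice2.
  - by exists 0, 0, 1; congr eis; ring.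
have [g [n [Gg ->]]] := screw_group_cosets sG Gphi pphi Gx.
set B := _ `|` _; have sB := generated_subgroup B.
apply: (subgroupM sB); last first.
  elim: n => [|n IHn]; first by rewrite expg0; apply: (subgroup1 sB).
  by rewrite expgS; apply: (subgroupM sB) => //; apply: sub_generated; right.
apply: sub_generated; left; exists g => //.
have sL := generated_subgroup [set Heis 1 0; Heis (omega R : R[i]) 0; Heis 0 c].
apply: (heis_lattice_min (N := N) sL); last by rewrite -LG.
- by rewrite e1; apply: sub_generated; left; left.
- by rewrite e2; apply: sub_generated; left; right.
- by rewrite e3; apply: sub_generated; right.
Qed.

End Normalized.

(** The translations by (1 / N) Z[omega] normalize the standard lattice. *)
Lemma conj_normalized N Gamma (w : heis R) (m n : int) :
  w = eis (m%:~R / N%:R) (n%:~R / N%:R) 0 -> (0 < N)%N ->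
  @of_heis R @^-1` Gamma = heis_lattice N ->
  @of_heis R @^-1` [set (x ^ of_heis w)%g | x in Gamma] = heis_lattice N.
Proof.
move=> -> N0 LG; have NR0 : N%:R != 0 :> R by rewrite pnatr_eq0 -lt0n.
have stable (k l : int) :
    {homo (fun g => g ^ eis (k%:~R / N%:R) (l%:~R / N%:R) 0)%g :
      g / heis_lattice N g}.
  move=> _ [a [b [j ->]]]; exists a, b, (j + (b * k - a * l)); rewrite eisJ.
  by rewrite rmorphD rmorphB !rmorphM /=; congr eis; field.
have wV : (eis (m%:~R / N%:R) (n%:~R / N%:R) 0)^-1%g =
    eis ((- m)%:~R / N%:R) ((- n)%:~R / N%:R) 0 :> heis R.
  by rewrite eisV !rmorphN; congr eis; ring.
apply/seteqP; split=> g.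
  move=> /conjugate_imageP; rewrite -of_heisV -of_heisJ.
  rewrite -[Gamma _]/((_ @^-1` Gamma) _).
  by rewrite LG => /(stable m n); rewrite conjgKV.
move=> Lg; apply/conjugate_imageP; rewrite -of_heisV -of_heisJ.
rewrite -[Gamma _]/((_ @^-1` Gamma) _).
by rewrite LG wV; apply: stable.
Qed.

Lemma omega_half : (0 - 2^-1 / 2) +i* (2^-1 * h) = cval (omega R) / 2.
Proof.
have two0 : 2 != 0 :> R[i] by rewrite pnatr_eq0.
apply: (mulIf two0); rewrite mulfVK // mulr_natr mulr2n omegaE.
move: (h) => k; apply/eqP; rewrite eq_complex /=.
by apply/andP; split; apply/eqP; field.
Qed.

Lemma phiE N (c : R) : c = 4 * h / N%:R -> N%:R != 0 :> R ->
  phi_ c = HeisC (eis 0 2^-1 (1 / (3 * N%:R) + 24^-1)) (omega R).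
Proof.
move=> -> NR0; rewrite /phi_ -omega_half /eis; congr (HeisC (Heis _ _)).
by move: (h) => k; field.
Qed.

Lemma phi'E N (c : R) : c = 4 * h / N%:R -> N%:R != 0 :> R ->
  phi_' c = HeisC (eis 0 2^-1 (2 / (3 * N%:R) + 24^-1)) (omega R).
Proof.
move=> -> NR0; rewrite /phi_' -omega_half /eis; congr (HeisC (Heis _ _)).
by move: (h) => k; field.
Qed.

(** The cube j / N of the centred element has j different from 0 and N modulo 3. This
    leaves both residues 1 and 2 when 3 divides N, and only - N otherwise. *)
Lemma normalized_classification N Gamma : (0 < N)%N -> screw_group Gamma ->
  @of_heis R @^-1` Gamma = heis_lattice N ->
  let c := 4 * h / N%:R in
  [/\ (N = 0 %[mod 3])%N ->
        conjugate_sets Gamma (Gamma_ c) \/ conjugate_sets Gamma (Gamma_' c),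
      (N = 1 %[mod 3])%N -> conjugate_sets Gamma (Gamma_' c)
    & (N = 2 %[mod 3])%N -> conjugate_sets Gamma (Gamma_ c)].
Proof.
move=> N0 sG LG c; have NR0 : N%:R != 0 :> R by rewrite pnatr_eq0 -lt0n.
have [x [y [s [m [n [Gg xE yE /dvdzP[f fE]]]]]]] := screw_class_trivial N0 sG LG.
(* Conjugation by (u, v, 0) adds (omega - 1) (u + v omega) to the planar part, so
   u + v = m / N and 2 v - u = n / N make it omega / 2. *)
pose w : heis R := eis ((m - f)%:~R / N%:R) (f%:~R / N%:R) 0.
pose Gamma' := [set (z ^ of_heis w)%g | z in Gamma].
have sG' : screw_group Gamma' by apply: conj_screw_group.
have LG' := conj_normalized (erefl w) N0 LG.
have conjG' : conjugate_sets Gamma Gamma' by exists (of_heis w).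
have [s' Gg'] : exists s', Gamma' (HeisC (eis 0 2^-1 s') (omega R)).
  eexists; exists (HeisC (eis x y s) (omega R)) => //.
  rewrite conjgE -of_heisV /w eisV /of_heis !heisC_mulE mul1g mulg1 mu1.
  rewrite mu_omega_eis !eisM; congr HeisC; congr eis.
    by rewrite xE rmorphB; field.
  have -> : y = 2^-1 + (3 * f%:~R - m%:~R) / N%:R.
    rewrite yE; congr (_ + _ / _).
    have := congr1 (fun z : int => z%:~R : R) fE.
    by rewrite rmorphD rmorphM /=; lra.
  by rewrite rmorphB; field.
have [r [r12 rN Gphi]] := centered_screw_ex N0 sG' LG' Gg'.
have G1 : r = 1 -> conjugate_sets Gamma (Gamma_ c).
  move=> r1; move: Gphi; rewrite r1 -(phiE (erefl c)) // => Gphi.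
  suff <- : Gamma' = Gamma_ c by [].
  exact: (screw_group_generated sG' LG').
have G2 : r = 2 -> conjugate_sets Gamma (Gamma_' c).
  move=> r2; move: Gphi; rewrite r2 -(phi'E (erefl c)) // => Gphi.
  suff <- : Gamma' = Gamma_' c by [].
  exact: (screw_group_generated sG' LG').
split=> Nmod.
- by case: r12 => [/G1|/G2]; [left|right].
- by apply: G2; lia.
- by apply: G1; lia.
Qed.

End ScrewGroups.

(** * Consequences of discreteness and cocompactness *)

Section Topology.
Variables (R : realType) (Gamma : set (heisC R)).
Implicit Types (x y s t : R) (g : heis R).

Lemma discrete_centre : Gamma 1%g -> Gamma `<=` isolated Gamma ->
  exists2 e : R, 0 < e & forall t, Gamma (of_heis (Heis 0 t)) -> `|t| < e -> t = 0.
Proof.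
move=> G1 /(_ _ G1)[_ [V V1 VG]].
pose f (t : R) : heisC R := of_heis (Heis 0 t).
have fc : continuous f.
  apply: continuous_comp_initial => t.
  apply: (cvg_pair (F := nbhs t) (G := nbhs (Heis 0 t : heis R))
    (H := nbhs (1%g : cstar R)) (f := fun t : R => Heis 0 t)
    (g := fun=> 1%g)); last exact: cvg_cst.
  move: t; apply: continuous_comp_initial => t.
  apply: (cvg_pair (F := nbhs t) (G := nbhs (0 : R[i]^o)) (H := nbhs t)
    (f := fun=> 0) (g := id)); first exact: cvg_cst.
  exact: cvg_id.
have := fc 0 V V1; rewrite nbhs_simpl => /nbhs_ballP[e /= e0 Ve].
exists e => // t Gt te; suff : (V `&` Gamma) (f t) by rewrite VG => -[].
by split=> //; apply: Ve; rewrite /ball /= sub0r normrN.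
Qed.

Lemma normc_sub_continuous (z0 : R[i]) :
  continuous (fun z : R[i]^o => normc (z - z0)).
Proof.
move=> z P /nbhs_ballP[e /= e0 eP].
change (nbhs (z : R[i]^o) [set z' | P (normc (z' - z0))]).
apply/nbhs_ballP; exists (e%:C : R[i]); first by rewrite /= ltcR.
move=> z'; rewrite -ball_normE /= => zz'.
have {}zz' : normc (z - z') < e by rewrite -ltcR.
apply: eP; rewrite -ball_normE /=; apply: le_lt_trans zz'.
have le1 (a b : R[i]) : normc a - normc b <= normc (a - b).
  by rewrite lerBlDr; apply: le_trans (le_normcD _ _); rewrite subrK.
have := le1 (z - z0) (z' - z0); have := le1 (z' - z0) (z - z0).
have -> : z - z0 - (z' - z0) = z - z' by ring.
have -> : normc (z' - z0 - (z - z0)) = normc (z - z').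
  by rewrite -normcN; congr normc; ring.
by rewrite ler_norml; lra.
Qed.

Lemma normc_dist_continuous (z0 : R[i]) :
  continuous (fun g : heis R => normc (hz g - z0)).
Proof.
move=> g.
apply: (@continuous_comp _ _ _ (@heis_pair R) (fun p => normc (p.1 - z0))).
  exact: initial_continuous.
apply: (@continuous_comp _ _ _ fst (fun z : R[i]^o => normc (z - z0))).
  exact: cvg_fst.
exact: normc_sub_continuous.
Qed.

(** If all translations in Gamma were central, Gamma would act on the plane through
    rotations about a single point z0. The distance to z0 would then be a continuous
    unbounded function on the compact orbit space. *)
Lemma cocompact_projection_neq0 : heis_bieberbach Gamma -> screw_group Gamma ->
  exists2 g, Gamma (of_heis g) & hz g != 0.
Proof.
move=> bG sG; have [sub _ _] := sG.
apply: contrapT => noz; have hz0 g : Gamma (of_heis g) -> hz g = 0.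
  by move=> Gg; apply/eqP; apply: contra_notT noz => gz; exists g.
have [x [y [s]]] := screw_group_ex sG; set phi := HeisC _ _ => Gphi.
pose z0 := hz (pr1 phi) / (1 - cval (omega R)).
have omega1 : 1 - cval (omega R) != 0.
  rewrite subr_eq0; apply/eqP => o1; apply: (@omega_neq1 R).
  exact: val_inj.
pose fix_ (x : heisC R) := hz (pr1 x) = z0 - cval (pr2 x) * z0.
have fixM u v : fix_ u -> fix_ v -> fix_ (u * v)%g.
  by rewrite /fix_ /= => -> ->; ring.
have fixphi : fix_ phi.
  by rewrite /fix_ -[X in _ = X - _]mul1r -mulrBl mulrC /z0 mulfVK.
have fixG u : Gamma u -> fix_ u.
  move=> /(screw_group_cosets sG Gphi (erefl _))[g [n [Gg ->]]].
  apply: (fixM); first by rewrite /fix_ /= hz0 // mul1r subrr.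
  elim: n => [|n IHn]; first by rewrite /fix_ /= mul1r subrr.
  by rewrite expgS; apply: fixM.
pose f g := normc (hz g - z0).
have finv u g : Gamma u -> f (heis_act u g) = f g.
  move=> Gx1; rewrite /f /= (fixG _ Gx1) addrAC [_ - z0]addrAC subrr sub0r.
  rewrite addrC -mulrBr normcM.
  by have := bieb_S1 bG Gx1; rewrite /heisS1 /= => ->; rewrite mul1r.
have fpi a b : (\pi_(orbit_space Gamma) a == \pi_(orbit_space Gamma) b)%qT ->
    f a = f b.
  move=> /eqP /eqmodP /asboolP ab.
  have : orbit_of Gamma b b.
    by exists 1%g; [apply: subgroup1|rewrite /heis_act mu1 mul1g].
  by rewrite -ab => -[u Gu <-]; rewrite finv.
have fq : continuous (f \o repr : orbit_space Gamma -> R).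
  apply: repr_comp_continuous; first exact: normc_dist_continuous.
  by move=> a b /fpi ->.
have : compact ((f \o repr) @` [set: orbit_space Gamma]).
  apply: continuous_compact (bieb_cocompact bG).
  exact: continuous_subspaceT.
move=> /compact_bounded[M [_ /(_ (M + 1))]].
rewrite ltrDl ltr01 => /(_ isT) fM.
pose a := Heis (z0 + (`|M| + 2)%:C) 0.
have : `|f a| <= M + 1.
  apply: fM; exists (\pi_(orbit_space Gamma)%qT a) => //=.
  by apply: fpi; rewrite reprK.
have -> : f a = `|M| + 2.
  have -> : f a = normc (`|M| + 2)%:C.
    by congr normc; apply/eqP; rewrite subr_eq addrC.
  rewrite /= expr0n addr0 sqrtr_sqr.
  by rewrite ger0_norm // addr_ge0.
have M2 : 0 <= `|M| + 2 by rewrite addr_ge0.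
by have := ler_norm M; rewrite (ger0_norm M2); lra.
Qed.

End Topology.

(** * Normal form of a rotation-stable lattice *)

(** A value that is not minimal can be lowered by at least e, which a nonnegative
    function allows finitely often. *)
Lemma discrete_argmin (R : archiRealFieldType) (T : Type) (A : T -> Prop)
    (q : T -> R) (e : R) :
  0 < e -> (exists a, A a) -> (forall a, A a -> 0 <= q a) ->
  (forall a b, A a -> A b -> q b < q a -> q b + e <= q a) ->
  exists2 a, A a & forall b, A b -> q a <= q b.
Proof.
move=> e0 [a Aa] q0 gap.
have : q a < (Num.truncn (q a / e)).+1%:R * e by rewrite -ltr_pdivrMr // truncnS_gt.
move: (Num.truncn _).+1 => n; elim: n a Aa => [|n IHn] a Aa qa.
  by move: qa (q0 _ Aa); rewrite mul0r; lra.
have [amin|] := pselect (forall b, A b -> q a <= q b); first by exists a.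
move=> /existsNP[b /not_implyP[Ab /negP]]; rewrite -ltNge => ba.
apply: (IHn b) => //; have := gap _ _ Aa Ab ba.
by move: qa; rewrite -natr1 mulrDl mul1r; lra.
Qed.

Lemma discrete_subgroup_cyclic (R : archiRealFieldType) (A : R -> Prop) (e : R) :
  (forall a b, A a -> A b -> A (a - b)) -> 0 < e ->
  (forall a, A a -> `|a| < e -> a = 0) -> (exists2 a, A a & 0 < a) ->
  exists2 c, 0 < c & forall a, A a <-> exists k : int, a = k%:~R * c.
Proof.
move=> AB e0 sep [a0 Aa0 a00].
have A0 : A 0 by rewrite -(subrr a0); apply: AB.
have AN a : A a -> A (- a) by move=> Aa; rewrite -sub0r; apply: AB.
have AD a b : A a -> A b -> A (a + b).
  by move=> Aa Ab; rewrite -[b]opprK; apply: (AB) => //; apply: AN.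
have [c [Ac c0] cmin] : exists2 c, A c /\ 0 < c & forall b, A b /\ 0 < b -> c <= b.
  apply: (@discrete_argmin _ _ _ id e) => //; first by exists a0.
    by move=> a [_ /ltW].
  move=> a b [Aa _] [Ab _] ba; rewrite -lerBrDl leNgt; apply/negP => abe.
  have := sep _ (AB _ _ Aa Ab); rewrite gtr0_norm ?subr_gt0 // => /(_ abe).
  by lra.
have Ak (k : int) : A (k%:~R * c).
  elim/int_ind: k => [|n IHn|n IHn]; first by rewrite mul0r.
    by rewrite -[n.+1]addn1 PoszD rmorphD mulrDl mul1r; apply: AD.
  by rewrite -[n.+1]addn1 PoszD opprD rmorphD mulrDl rmorphN1 mulN1r; apply: AB.
exists c => // a; split=> [Aa|[k ->] //].
exists (Num.floor (a / c)); apply/eqP; rewrite -subr_eq0; apply/eqP.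
set d := _ - _; have Ad : A d by apply: AB.
have d0 : 0 <= d by rewrite subr_ge0 -ler_pdivlMr // floor_le_tmp.
have dc : d < c.
  rewrite ltrBlDr -{1}[c]mul1r -mulrDl addrC -ltr_pdivrMr //.
  by have := floorD1_gt (a / c); rewrite rmorphD.
apply/eqP; rewrite eq_le d0 andbT leNgt; apply/negP => d1.
by have := cmin _ (conj Ad d1); lra.
Qed.

Section LatticeNormalForm.
Variable R : realType.
Implicit Types (x y s t : R) (g : heis R) (L : set (heis R)).

Lemma eis_norm_ge0 x y : 0 <= eis_norm x y.
Proof.
have -> : eis_norm x y = (x - y / 2) ^+ 2 + 3 / 4 * y ^+ 2 by field.
by have := sqr_ge0 (x - y / 2); have := sqr_ge0 y; lra.
Qed.

Lemma eis_norm_eq0 x y : eis_norm x y = 0 -> x = 0 /\ y = 0.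
Proof.
have -> : eis_norm x y = (x - y / 2) ^+ 2 + 3 / 4 * y ^+ 2 by field.
move=> e; have y0 : y = 0.
  by apply/eqP; rewrite -sqrf_eq0; apply/eqP;
    have := sqr_ge0 (x - y / 2); have := sqr_ge0 y; lra.
split=> //; apply/eqP; rewrite -sqrf_eq0; apply/eqP.
by move: e; rewrite y0; nra.
Qed.

(** Conjugation by an element over omega rotates a translation and changes its height;
    the change of height is left free. *)
Definition rotation_stable L :=
  forall x y s, L (eis x y s) -> exists s', L (eis (- y) (x - y) s').

(** The commutator of an element over p with one over omega p is the central element
    whose height is the squared length of p. Squared lengths are therefore multiples
    of the generator c of the centre, and a shortest vector exists. *)
Lemma lattice_minimal_vector L (e : R) :
  is_subgroup L -> rotation_stable L -> 0 < e ->
  (forall s, L (eis 0 0 s) -> `|s| < e -> s = 0) ->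
  (exists x y s, L (eis x y s) /\ eis_norm x y != 0) ->
  exists c x0 y0 s0, [/\ 0 < c,
    forall s, L (eis 0 0 s) <-> exists k : int, s = k%:~R * c,
    L (eis x0 y0 s0), 0 < eis_norm x0 y0 &
    forall x y s, L (eis x y s) ->
      eis_norm x y != 0 -> eis_norm x0 y0 <= eis_norm x y].
Proof.
move=> sL rL e0 sep [x1 [y1 [s1 [L1 n1]]]].
have Lnorm x y s : L (eis x y s) -> L (eis 0 0 (eis_norm x y)).
  move=> Lxys; have [s' Ls'] := rL _ _ _ Lxys.
  have := subgroupM sL (subgroupM sL (subgroupV sL Ls') (subgroupV sL Lxys))
    (subgroupM sL Ls' Lxys).
  by rewrite !eisV !eisM; congr (L (eis _ _ _)); field.
have [c c0 cyc] : exists2 c, 0 < c &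
    forall s, L (eis 0 0 s) <-> exists k : int, s = k%:~R * c.
  apply: (@discrete_subgroup_cyclic _ (fun s => L (eis 0 0 s)) e) => //.
    move=> a b La Lb; have := subgroupM sL La (subgroupV sL Lb).
    by rewrite eisV eisM; congr (L (eis _ _ _)); field.
  exists (eis_norm x1 y1); first exact: Lnorm L1.
  by rewrite lt_neqAle eq_sym n1 eis_norm_ge0.
pose A (p : R * R * R) := L (eis p.1.1 p.1.2 p.2) /\ eis_norm p.1.1 p.1.2 != 0.
have [] := @discrete_argmin R _ A (fun p => eis_norm p.1.1 p.1.2) c c0.
- by exists (x1, y1, s1).
- by move=> p _; apply: eis_norm_ge0.
- move=> [[x y] s] [[x' y'] s'] [/= /Lnorm/cyc[k ->] _] [/Lnorm/cyc[k' ->] _].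
  rewrite ltr_pM2r // ltr_int => kk'.
  rewrite -[X in _ + X]mul1r -mulrDl ler_pM2r // -[1]/(1%:~R) -rmorphD ler_int.
  by lia.
move=> [[x0 y0] s0] [/= L0 n0] min0.
exists c, x0, y0, s0; split=> //; first by rewrite lt_neqAle eq_sym n0 eis_norm_ge0.
by move=> x y s Lxys nxy; apply: (min0 (x, y, s)).
Qed.

(** Rounding both coordinates leaves a remainder of squared length at most 3 / 4: this
    is why Z[omega] is Euclidean. *)
Lemma round_half (x : R) : exists k : int, (x - k%:~R) ^+ 2 <= 4^-1.
Proof.
exists (Num.floor (x + 2^-1)).
have := floor_le_tmp (x + 2^-1); have := floorD1_gt (x + 2^-1).
rewrite rmorphD /=; move: (Num.floor _)%:~R => k; nra.
Qed.

(** When 1 is a shortest vector, the projection of L to the plane is Z[omega] by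
    Euclidean division. The commutator of lifts of 1 and omega has height 1, so the
    generator c of the centre is 1 / N; conjugation by a translation brings the two
    lifts to height 0. *)
Lemma unit_lattice_normal_form L (c s1 : R) :
  is_subgroup L -> rotation_stable L -> 0 < c ->
  (forall s, L (eis 0 0 s) <-> exists k : int, s = k%:~R * c) ->
  L (eis 1 0 s1) ->
  (forall x y s, L (eis x y s) -> eis_norm x y != 0 -> 1 <= eis_norm x y) ->
  exists N (w : heis R), (0 < N)%N /\
    [set g | L (g ^ w^-1)%g] = heis_lattice N.
Proof.
move=> sL rL c0 cyc L1 min1.
have [s2 L2] : exists s2, L (eis 0 1 s2).
  have [s2] := rL _ _ _ L1; rewrite subr0 oppr0 => L2; by exists s2.
have [N N0 cE] : exists2 N, (0 < N)%N & c = N%:R^-1.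
  have : L (eis 0 0 1).
    have := subgroupM sL (subgroupM sL (subgroupV sL L2) (subgroupV sL L1))
    (subgroupM sL L2 L1).
    by rewrite !eisV !eisM; congr (L (eis _ _ _)); field.
  move=> /cyc[[k|k] kE].
    have k0 : (0 < k)%N.
      rewrite lt0n; apply/eqP => k0; move: kE.
      by rewrite k0 mul0r => /eqP; rewrite oner_eq0.
    exists k => //; apply: (mulfI (x := k%:R)); first by rewrite pnatr_eq0 -lt0n.
    by rewrite mulfV ?pnatr_eq0 -?lt0n // [RHS]kE.
  have : k.+1%:R * c > 0 :> R by rewrite mulr_gt0 ?ltr0Sn.
  by move: kE; rewrite NegzE rmorphN /= mulNr -pmulrn; lra.
have NR0 : N%:R != 0 :> R by rewrite pnatr_eq0 -lt0n.
exists N, (eis (- s2) s1 0); split=> //.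
set L' := [set _ | _].
have L'E x y s : L' (eis x y s) <-> L (eis x y (s + (y * s2 + x * s1))).
  by rewrite /L' /= eisV eisJ; split; congr (L (eis _ _ _)); ring.
have sL' : is_subgroup L'.
  by apply: (preimage_subgroup (f := fun g => (g ^ _)%g)) => // g g'; rewrite conjMg.
have L'1 : L' (eis 1 0 0) by apply/L'E; move: L1; congr (L (eis _ _ _)); ring.
have L'2 : L' (eis 0 1 0) by apply/L'E; move: L2; congr (L (eis _ _ _)); ring.
have cyc' s : L' (eis 0 0 s) <-> exists k : int, s = k%:~R / N%:R.
  have -> : L' (eis 0 0 s) <-> L (eis 0 0 s).
    by rewrite L'E; split; congr (L (eis _ _ _)); ring.
  by rewrite cyc cE.
apply/seteqP; split; last first.
  apply: heis_lattice_min => //; apply/cyc'.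
  by exists 1; rewrite mul1r.
move=> g; have [x [y [s ->]]] := eis_ex g => Lg.
have [k kx] := round_half x; have [l ly] := round_half y.
have Lkl : L' (eis (x - k%:~R) (y - l%:~R)
    (s + k%:~R * l%:~R / 2 + (l%:~R * x - k%:~R * y) / 2)).
  have := subgroupM sL' Lg (subgroupM sL' (subgroup_eis_zmul (- l) sL' L'2)
    (subgroup_eis_zmul (- k) sL' L'1)).
  by rewrite !eisM !rmorphN /=; congr (L' (eis _ _ _)); field.
have [xk yl] : x - k%:~R = 0 /\ y - l%:~R = 0.
  apply: eis_norm_eq0; apply/eqP; apply: contraT => nz.
  move: Lkl => /L'E /min1 /(_ nz); move: kx ly.
  by move: (x - _) (y - _) => a b; nra.
have {}xk : x = k%:~R by lra.
have {}yl : y = l%:~R by lra.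
move: Lkl; rewrite xk yl !subrr => /cyc'[j jE].
by exists k, l, j; congr eis; rewrite -jE; field.
Qed.

Fact eis_cstar_neq0 x0 y0 : 0 < eis_norm x0 y0 -> hz (eis x0 y0 0) != 0.
Proof.
move=> n0; apply/eqP => /hz_eis_eq0[x00 y00].
by move: n0; rewrite x00 y00; lra.
Qed.

Definition eis_cstar x0 y0 (n0 : 0 < eis_norm x0 y0) : cstar R :=
  CStar (eis_cstar_neq0 n0).

Lemma mu_eis x0 y0 (n0 : 0 < eis_norm x0 y0) x y s :
  mu_ (eis_cstar n0) (eis x y s) =
  eis (x0 * x - y0 * y) (x0 * y + y0 * x - y0 * y) (eis_norm x0 y0 * s).
Proof.
have hh := im_omega_sqr R.
rewrite /mu_ [cval _]/(hz (eis x0 y0 0)) /eis.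
move: (complex.Im _) hh => k hh /=; congr Heis.
  congr Complex; last by field.
  by transitivity ((x0 - y0 / 2) * (x - y / 2) - y0 * y * (k * k));
    [field|rewrite hh; field].
rewrite sqr_sqrtr ?addr_ge0 ?sqr_ge0 // exprMn [k ^+ 2]expr2 hh.
by field.
Qed.

(** A homothety turns a shortest vector of L into 1. *)
Lemma lattice_normal_form L (e : R) :
  is_subgroup L -> rotation_stable L -> 0 < e ->
  (forall s, L (eis 0 0 s) -> `|s| < e -> s = 0) ->
  (exists x y s, L (eis x y s) /\ eis_norm x y != 0) ->
  exists N (l : cstar R) (w : heis R), (0 < N)%N /\
    [set g | L (mu_ l (g ^ w^-1)%g)] = heis_lattice N.
Proof.
move=> sL rL e0 sep nz.
have [c [x0 [y0 [s0 [c0 cyc L0 n0 min0]]]]] :=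
  lattice_minimal_vector sL rL e0 sep nz.
have n00 : eis_norm x0 y0 != 0 by rewrite gt_eqF.
pose l := eis_cstar n0; pose L1 := mu_ l @^-1` L.
have L1E x y s : L1 (eis x y s) <->
    L (eis (x0 * x - y0 * y) (x0 * y + y0 * x - y0 * y) (eis_norm x0 y0 * s)).
  by rewrite -mu_eis.
have [||||||N [w [N0 wE]]] :=
  @unit_lattice_normal_form L1 (c / eis_norm x0 y0) (s0 / eis_norm x0 y0).
- by apply: preimage_subgroup sL; apply: muM.
- move=> x y s /L1E /rL[s' Ls']; exists (s' / eis_norm x0 y0); apply/L1E.
  move: Ls'; congr (L (eis _ _ _)); try ring.
  by rewrite mulrCA mulfV ?mulr1.
- by rewrite divr_gt0.
- move=> s; rewrite L1E.
  have -> : L (eis (x0 * 0 - y0 * 0) (x0 * 0 + y0 * 0 - y0 * 0)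
      (eis_norm x0 y0 * s)) <-> L (eis 0 0 (eis_norm x0 y0 * s)).
    by split; congr (L (eis _ _ _)); ring.
  rewrite cyc; split=> -[k kE]; exists k.
    by rewrite mulrA -kE mulrAC mulfV ?mul1r.
  by rewrite kE; field.
- apply/L1E; move: L0; congr (L (eis _ _ _)); try ring.
  by rewrite mulrCA mulfV ?mulr1.
- move=> x y s /L1E /min0.
  have -> : eis_norm (x0 * x - y0 * y) (x0 * y + y0 * x - y0 * y) =
    eis_norm x0 y0 * eis_norm x y by ring.
  rewrite mulf_eq0 negb_or n00 /= => /[apply].
  by rewrite -{1}[eis_norm x0 y0]mulr1 ler_pM2l.
by exists N, l, w.
Qed.

End LatticeNormalForm.

(** * Normalization of a Bieberbach group *)

Section Normalization.
Variable R : realType.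
Implicit Types (x y s : R) (g : heis R) (Gamma : set (heisC R)).

Local Notation h := (complex.Im (cval (omega R))).

Lemma screw_rotation_stable Gamma :
  screw_group Gamma -> rotation_stable (@of_heis R @^-1` Gamma).
Proof.
move=> sG x y s Gg; have [sub _ _] := sG.
have [a [b [t]]] := screw_group_ex sG; set phi := HeisC _ _ => Gphi.
exists (s + ((x - y) * - a - - y * - b)); rewrite /preimage /=.
have : Gamma (phi * of_heis (eis x y s) * phi^-1)%g.
  by apply: (subgroupM sub); [apply: (subgroupM sub)|apply: (subgroupV sub)].
rewrite heisC_conj_of_heis mulgK mu_omega_eis eisV eisJ.
by [].
Qed.

Lemma bieberbach_normalization Gamma :
  heis_bieberbach Gamma -> screw_group Gamma ->
  exists N (w : heisC R), (0 < N)%N /\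
    @of_heis R @^-1` [set (x ^ w)%g | x in Gamma] = heis_lattice N.
Proof.
move=> bG sG; have [sub _ _] := sG; pose L := @of_heis R @^-1` Gamma.
have sL : is_subgroup L by apply: preimage_subgroup sub; apply: of_heisM.
have h0 := im_omega_gt0 R.
have [e e0 sep] := discrete_centre (subgroup1 sub) (bieb_discrete bG).
have eisE s : eis 0 0 s = Heis 0 (4 * h * s).
  by rewrite /eis; congr Heis; congr Complex; ring.
have [|||N [l [w [N0 LN]]]] :=
    @lattice_normal_form R L (e / (4 * h)) sL (screw_rotation_stable sG).
- by rewrite divr_gt0 ?mulr_gt0.
- move=> s; rewrite /L /= eisE => /sep; rewrite normrM gtr0_norm ?mulr_gt0 //.
  rewrite ltr_pdivlMr ?mulr_gt0 // mulrC => /[apply] /eqP.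
  by rewrite mulf_eq0 gt_eqF ?mulr_gt0 //= => /eqP.
- have [g Gg g0] := cocompact_projection_neq0 bG sG.
  have [x [y [s gE]]] := eis_ex g; exists x, y, s; rewrite -gE; split=> //.
  apply: contraNneq g0 => /eis_norm_eq0[x0 y0]; rewrite gE x0 y0 /eis.
  by rewrite mul0r mul0r subr0.
exists N, (HeisC 1%g l * of_heis w)%g; split=> //; rewrite -LN.
have conjE g : (of_heis g ^ (HeisC 1%g l * of_heis w)^-1)%g =
    of_heis (mu_ l (g ^ w^-1)%g).
  rewrite invgM -of_heisV conjgM -of_heisJ conjgE invgK mulgA.
  by rewrite heisC_conj_of_heis invg1 conjg1 mulgK.
apply/seteqP; split=> g; first by move=> /conjugate_imageP; rewrite conjE.
by move=> Lg; apply/conjugate_imageP; rewrite conjE.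
Qed.

Lemma normalized_quotient_card N Gamma (w : heisC R) : (0 < N)%N ->
  @of_heis R @^-1` [set (x ^ w)%g | x in Gamma] = heis_lattice N ->
  let Lambda := Gamma `&` @heis_sub R in
  quotient_card (centerg Lambda) (commutator_subgroup Lambda) = N.
Proof.
move=> N0 LG Lambda.
have conjM : {morph (fun x : heisC R => x ^ w)%g : x y / (x * y)%g}.
  by move=> x y; apply: conjMg.
have LambdaJ : [set (x ^ w)%g | x in Lambda] = @of_heis R @` heis_lattice N.
  rewrite -LG; apply/seteqP; split=> [_ [x [Gx [g _ gx]] <-]|_ [g [x Gx xg] <-]].
    have xwE : (x ^ w)%g = of_heis (pr1 (x ^ w)%g).
      by apply: of_heis_pr1; rewrite pr2J -gx.
    by exists (pr1 (x ^ w)%g) => //=; rewrite -xwE; exists x.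
  exists x => //; split=> //; exists (pr1 x) => //.
  by rewrite -of_heis_pr1 // -(pr2J x w) xg.
rewrite -(quotient_card_image conjM (conjg_inj w)).
rewrite -(image_centerg conjM (conjg_inj w)) -(image_commutator_subgroup conjM).
rewrite LambdaJ (image_centerg (@of_heisM R) (@of_heis_inj R)).
rewrite (image_commutator_subgroup (@of_heisM R)).
rewrite (quotient_card_image (@of_heisM R) (@of_heis_inj R)).
exact: quotient_card_heis_lattice.
Qed.

End Normalization.

Theorem proposition7p1 (R : realType) (Gamma : set (heisC R)) :
  heis_bieberbach Gamma ->
  @pr2 R @` Gamma = generated [set omega R] ->
  let Lambda := Gamma `&` @heis_sub R in
  let N := quotient_card (centerg Lambda) (commutator_subgroup Lambda) in
  let c := 4 * complex.Im (omega R) / N%:R in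
  [/\ (N = 0 %[mod 3])%N ->
        conjugate_sets Gamma (Gamma_ c) \/ conjugate_sets Gamma (Gamma_' c),
      (N = 1 %[mod 3])%N -> conjugate_sets Gamma (Gamma_' c)
    & (N = 2 %[mod 3])%N -> conjugate_sets Gamma (Gamma_ c)].
Proof.
move=> bG pr2G Lambda N c.
have sG : screw_group Gamma.
  by split; [apply: bieb_subgroup bG|apply: bieb_torsion_free bG|].
have [M [w [M0 LM]]] := bieberbach_normalization bG sG.
have NM : N = M := normalized_quotient_card M0 LM.
have conjG : conjugate_sets Gamma [set (x ^ w)%g | x in Gamma] by exists w.
have [G0 G1 G2] := normalized_classification M0 (conj_screw_group w sG) LM.
rewrite /c NM; split=> [/G0[] G'|/G1 G'|/G2 G'].
- by left; apply: conjugate_sets_trans G'.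
- by right; apply: conjugate_sets_trans G'.
- exact: conjugate_sets_trans G'.
- exact: conjugate_sets_trans G'.
Qed.
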